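(* (ZF) If the hypergraph $\Gamma_T$ has countable chromatic number, then there is a total countable-to-one map from $\mathbb{R}$ to $\omega_1$.
   Context: $\Gamma_R$ is the hypergraph of arity four on $\mathbb{R}^2$ consisting of all sets $a\times b$ where $a,b\subset\mathbb{R}$ each have exactly two elements. $\Gamma_T$ is the hypergraph of arity three on $\mathbb{R}^2$ consisting of all three-element sets $e\subset\mathbb{R}^2$ such that $e\cup\{z\}\in\Gamma_R$ for some point $z\in\mathbb{R}^2$. Countable chromatic number means there is a function $c\colon\mathbb{R}^2\to\omega$ such that no hyperedge is $c$-monochromatic. A map is countable-to-one if every fiber is countable. *)

(* Defs.v *)
(* The theorem is one of ZF without choice.  The ambient logic here has choice
   principles available, so it is stated as truth in every first-order model of
   ZF; by completeness this is the same as provability in ZF.  Everything below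
   (reals, naturals, ordinals, functions, countability, ...) is therefore
   relativized to the model: all quantifiers range over its elements, and all
   maps are sets of Kuratowski pairs belonging to it. *)

Set Implicit Arguments.
Unset Strict Implicit.

Record structure : Type := Structure {
  dom :> Type;
  mem : dom -> dom -> Prop
}.

Notation "x ∈ y" := (mem x y) (at level 70, no associativity).
Notation "x ∉ y" := (~ mem x y) (at level 70, no associativity).

(* First-order formulas of set theory, with de Bruijn indices.  They are needed
   because separation and replacement must be restricted to first-order
   definable properties: for arbitrary predicates of the ambient logic the
   model would inherit choice from outside. *)
Inductive formula : Type :=
| fMem : nat -> nat -> formula
| fEq : nat -> nat -> formula
| fBot : formula
| fImp : formula -> formula -> formula
| fAll : formula -> formula.

Definition scons (T : Type) (x : T) (r : nat -> T) (n : nat) : T :=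
  match n with 0 => x | S m => r m end.

Fixpoint sat (M : structure) (r : nat -> M) (p : formula) : Prop :=
  match p with
  | fMem i j => r i ∈ r j
  | fEq i j => r i = r j
  | fBot => False
  | fImp p q => sat r p -> sat r q
  | fAll p => forall x : M, sat (scons x r) p
  end.

Definition is_empty (M : structure) (x : M) : Prop := forall y, y ∉ x.

Definition subset (M : structure) (x y : M) : Prop := forall z, z ∈ x -> z ∈ y.

(* s = x ∪ {x} *)
Definition is_succ (M : structure) (s x : M) : Prop :=
  forall z, z ∈ s <-> z ∈ x \/ z = x.

Definition inductive (M : structure) (w : M) : Prop :=
  (exists e, is_empty e /\ e ∈ w) /\
  (forall x, x ∈ w -> exists s, is_succ s x /\ s ∈ w).

(* The free variables of the formulas in the two schemas other than the
   displayed ones are parameters, interpreted by r. *)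
Record ZF (M : structure) : Prop := {
  zf_extensionality :
    forall x y : M, (forall z, z ∈ x <-> z ∈ y) -> x = y;
  zf_foundation :
    forall x : M, (exists y, y ∈ x) ->
      exists y, y ∈ x /\ forall z, z ∈ x -> z ∉ y;
  zf_pairing :
    forall x y : M, exists p, forall z, z ∈ p <-> z = x \/ z = y;
  zf_union :
    forall x : M, exists u, forall z, z ∈ u <-> exists y, y ∈ x /\ z ∈ y;
  zf_power :
    forall x : M, exists p, forall z, z ∈ p <-> subset z x;
  zf_infinity :
    exists w : M, inductive w;
  zf_separation :
    forall (p : formula) (r : nat -> M) (x : M),
      exists y, forall z, z ∈ y <-> z ∈ x /\ sat (scons z r) p;
  zf_replacement :
    forall (p : formula) (r : nat -> M) (x : M),
      (forall u v v', u ∈ x ->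
         sat (scons u (scons v r)) p -> sat (scons u (scons v' r)) p ->
         v = v') ->
      exists y, forall v,
        v ∈ y <-> exists u, u ∈ x /\ sat (scons u (scons v r)) p
}.

Definition is_upair (M : structure) (p x y : M) : Prop :=
  forall z, z ∈ p <-> z = x \/ z = y.

(* p = (x, y) = {{x}, {x, y}} *)
Definition is_opair (M : structure) (p x y : M) : Prop :=
  exists a b, is_upair a x x /\ is_upair b x y /\ is_upair p a b.

Definition is_product (M : structure) (P A B : M) : Prop :=
  forall p, p ∈ P <-> exists a b, a ∈ A /\ b ∈ B /\ is_opair p a b.

(* (x, y) ∈ f; for a function f, this is f(x) = y *)
Definition app (M : structure) (f x y : M) : Prop :=
  exists p, is_opair p x y /\ p ∈ f.

Definition is_relation (M : structure) (f A B : M) : Prop :=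
  forall p, p ∈ f -> exists a b, a ∈ A /\ b ∈ B /\ is_opair p a b.

Definition is_function (M : structure) (f A B : M) : Prop :=
  is_relation f A B /\ forall a, a ∈ A -> exists! b, app f a b.

Definition injective (M : structure) (f : M) : Prop :=
  forall x x' y, app f x y -> app f x' y -> x = x'.

Definition is_omega (M : structure) (w : M) : Prop :=
  inductive w /\ forall i, inductive i -> subset w i.

Definition countable (M : structure) (X : M) : Prop :=
  exists w f, is_omega w /\ is_function f X w /\ injective f.

Definition transitive (M : structure) (x : M) : Prop :=
  forall y, y ∈ x -> subset y x.

Definition mem_well_orders (M : structure) (X : M) : Prop :=
  (forall x, x ∈ X -> x ∉ x) /\
  (forall x y z, x ∈ X -> y ∈ X -> z ∈ X -> x ∈ y -> y ∈ z -> x ∈ z) /\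
  (forall x y, x ∈ X -> y ∈ X -> x ∈ y \/ x = y \/ y ∈ x) /\
  (forall s, subset s X -> (exists x, x ∈ s) ->
     exists m, m ∈ s /\ forall x, x ∈ s -> m = x \/ m ∈ x).

Definition is_ordinal (M : structure) (a : M) : Prop :=
  transitive a /\ mem_well_orders a.

(* the least uncountable ordinal *)
Definition is_omega1 (M : structure) (w : M) : Prop :=
  is_ordinal w /\ ~ countable w /\ forall a, a ∈ w -> countable a.

Definition binary_operation (M : structure) (f X : M) : Prop :=
  exists P, is_product P X X /\ is_function f P X.

(* f(x, y) = z *)
Definition app2 (M : structure) (f x y z : M) : Prop :=
  exists p, is_opair p x y /\ app f p z.

Record complete_ordered_field (M : structure)
    (R plus times lt zero one : M) : Prop := {
  cof_plus : binary_operation plus R;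
  cof_times : binary_operation times R;
  cof_lt : is_relation lt R R;
  cof_zero : zero ∈ R;
  cof_one : one ∈ R;
  cof_one_neq_zero : one <> zero;
  cof_plus_comm : forall x y s, app2 plus x y s -> app2 plus y x s;
  cof_plus_assoc : forall x y z xy yz s,
    app2 plus x y xy -> app2 plus y z yz ->
    app2 plus xy z s -> app2 plus x yz s;
  cof_plus_zero : forall x, x ∈ R -> app2 plus x zero x;
  cof_plus_opp : forall x, x ∈ R -> exists y, y ∈ R /\ app2 plus x y zero;
  cof_times_comm : forall x y s, app2 times x y s -> app2 times y x s;
  cof_times_assoc : forall x y z xy yz s,
    app2 times x y xy -> app2 times y z yz ->
    app2 times xy z s -> app2 times x yz s;
  cof_times_one : forall x, x ∈ R -> app2 times x one x;
  cof_times_inv : forall x, x ∈ R -> x <> zero ->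
    exists y, y ∈ R /\ app2 times x y one;
  cof_distr : forall x y z yz xy xz s,
    app2 plus y z yz -> app2 times x y xy -> app2 times x z xz ->
    app2 times x yz s -> app2 plus xy xz s;
  cof_lt_irrefl : forall x, ~ app lt x x;
  cof_lt_trans : forall x y z, app lt x y -> app lt y z -> app lt x z;
  cof_lt_total : forall x y, x ∈ R -> y ∈ R ->
    app lt x y \/ x = y \/ app lt y x;
  cof_lt_plus : forall x y z xz yz,
    app lt x y -> app2 plus x z xz -> app2 plus y z yz -> app lt xz yz;
  cof_lt_times : forall x y xy,
    app lt zero x -> app lt zero y -> app2 times x y xy -> app lt zero xy;
  cof_complete : forall X, subset X R -> (exists x, x ∈ X) ->
    (exists b, b ∈ R /\ forall x, x ∈ X -> app lt x b \/ x = b) ->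
    exists l, l ∈ R /\
      (forall x, x ∈ X -> app lt x l \/ x = l) /\
      (forall b, b ∈ R -> (forall x, x ∈ X -> app lt x b \/ x = b) ->
         app lt l b \/ l = b)
}.

(* ZF proves that a complete ordered field exists and is unique up to
   isomorphism, so the reals are taken to be any one of them. *)
Definition is_reals (M : structure) (R : M) : Prop :=
  exists plus times lt zero one : M,
    complete_ordered_field R plus times lt zero one.

Definition two_elements (M : structure) (a : M) : Prop :=
  exists x y, x <> y /\ forall u, u ∈ a <-> u = x \/ u = y.

Definition three_elements (M : structure) (a : M) : Prop :=
  exists x y z, x <> y /\ x <> z /\ y <> z /\
    forall u, u ∈ a <-> u = x \/ u = y \/ u = z.

Definition Gamma_R (M : structure) (R e : M) : Prop :=
  exists a b, subset a R /\ two_elements a /\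
              subset b R /\ two_elements b /\ is_product e a b.

(* R2 is the plane R × R *)
Definition Gamma_T (M : structure) (R R2 e : M) : Prop :=
  subset e R2 /\ three_elements e /\
  exists z e', z ∈ R2 /\ (forall u, u ∈ e' <-> u ∈ e \/ u = z) /\ Gamma_R R e'.

Definition monochromatic (M : structure) (c e : M) : Prop :=
  exists n, forall p, p ∈ e -> app c p n.

Definition countable_chromatic_number (M : structure) (X : M)
    (Gamma : M -> Prop) : Prop :=
  exists w c, is_omega w /\ is_function c X w /\
    forall e, Gamma e -> ~ monochromatic c e.

Definition is_fiber (M : structure) (F f y : M) : Prop :=
  forall x, x ∈ F <-> app f x y.

Definition countable_to_one (M : structure) (f Y : M) : Prop :=
  forall y, y ∈ Y -> exists F, is_fiber F f y /\ countable F.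

(* Main.v *)
Require Import Defs.
From Stdlib Require Import Classical ClassicalEpsilon PeanoNat.

(* Let c be the colouring.  If (x, z) shares its colour both with another point
   of the column of x and with another point of the row of z, these three points
   form a monochromatic edge.  So, with A_x the set of z such that no other point
   of the column of x has the colour of (x, z): each A_x is countable via
   z |-> c (x, z), and for each z the set of x with z not in A_x is countable via
   x |-> c (x, z).  Fix a partial surjection "code" from R onto the countable
   ordinals, and map x to the least countable ordinal without a code in A_x.  If
   z codes a, then the fiber of a consists of x with z not in A_x, so it is
   countable.

   For the codes, a countable ordinal is represented by a subset s of ω × ω, and
   s by the real v (0, 0), where v p is v (nxt p) / 3, plus 2/3 if p is in s, for
   a walk nxt on ω × ω.  A solution v exists by a Knaster-Tarski argument,
   so no recursion on ω and no arithmetic of ω is needed. *)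

Set Implicit Arguments.
Unset Strict Implicit.

Existing Class ZF.

(** * Definability with parameters *)

Section Definability.
Variable M : structure.
Implicit Types (r rho e : nat -> M) (p q : formula).

Lemma sat_ext p r r' : (forall n, r n = r' n) -> (sat r p <-> sat r' p).
Proof.
revert r r'; induction p as [i j|i j| |p IHp q IHq|p IHp]; simpl; intros r r' E.
- rewrite !E; tauto.
- rewrite !E; tauto.
- tauto.
- rewrite (IHp r r' E), (IHq r r' E); tauto.
- split; intros H x; apply (IHp (scons x r) (scons x r')); auto;
    intros [|n]; simpl; auto.
Qed.

Definition lift_ren (f : nat -> nat) n := match n with 0 => 0 | S k => S (f k) end.

Fixpoint rename (f : nat -> nat) p : formula :=
  match p with
  | fMem i j => fMem (f i) (f j)
  | fEq i j => fEq (f i) (f j)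
  | fBot => fBot
  | fImp p q => fImp (rename f p) (rename f q)
  | fAll p => fAll (rename (lift_ren f) p)
  end.

Lemma sat_rename p f r : sat r (rename f p) <-> sat (fun n => r (f n)) p.
Proof.
revert f r; induction p as [i j|i j| |p IHp q IHq|p IHp]; simpl; intros f r; try tauto.
- rewrite IHp, IHq; tauto.
- split; intros H x.
  + eapply sat_ext; [|apply IHp, (H x)]; intros [|n]; reflexivity.
  + apply IHp; eapply sat_ext; [|exact (H x)]; intros [|n]; reflexivity.
Qed.

(* Interleaves the free variables r with the parameters rho, so that the
   parameters of two formulas can be merged. *)
Definition mix r rho n := if Nat.even n then r (Nat.div2 n) else rho (Nat.div2 n).

Lemma mix_even r rho i : mix r rho (2 * i) = r i.
Proof. unfold mix; rewrite Nat.even_even, Nat.div2_double; reflexivity. Qed.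

Lemma mix_odd r rho i : mix r rho (S (2 * i)) = rho i.
Proof.
unfold mix. rewrite Nat.div2_succ_double.
replace (S (2 * i)) with (2 * i + 1) by (rewrite Nat.add_1_r; reflexivity).
rewrite Nat.even_odd; reflexivity.
Qed.

(** Index counterpart of [mix]: a formula meant for [mix r rho] is renamed so that its variables are
    found through [a] and its parameters through [b]. *)
Definition mix_ren (a b : nat -> nat) n :=
  if Nat.even n then a (Nat.div2 n) else b (Nat.div2 n).

Lemma sat_mix_ren p e a b r rho :
  (forall i, e (a i) = r i) -> (forall i, e (b i) = rho i) ->
  (sat e (rename (mix_ren a b) p) <-> sat (mix r rho) p).
Proof.
intros Ea Eb; rewrite sat_rename; apply sat_ext; intros n.
unfold mix_ren, mix; destruct (Nat.even n); auto.
Qed.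

(** Predicates on whole assignments give closure rules that need no bound on the number of free
    variables. As [rho] is chosen before [r], it holds parameters only. *)
Definition Def (P : (nat -> M) -> Prop) : Prop :=
  exists p rho, forall r, sat (mix r rho) p <-> P r.

(* t is definable when its graph is; variable 0 stands for the value. *)
Definition DefTerm (t : (nat -> M) -> M) : Prop :=
  Def (fun r => r 0 = t (fun n => r (S n))).

Lemma Def_ext P Q : (forall r, P r <-> Q r) -> Def P -> Def Q.
Proof.
intros E [p [rho H]]; exists p, rho; intros r; rewrite H; apply E.
Qed.


Lemma Def_imp P Q : Def P -> Def Q -> Def (fun r => P r -> Q r).
Proof.
intros [p [rho H]] [q [rho' H']].
(* In [mix r (mix rho rho')] the entries of [rho] sit at the indices [S (2 * (2 * i))], those of
   [rho'] at [S (2 * S (2 * i))]. *)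
exists (fImp (rename (mix_ren (fun i => 2 * i) (fun i => S (2 * (2 * i)))) p)
             (rename (mix_ren (fun i => 2 * i) (fun i => S (2 * (S (2 * i))))) q)),
  (mix rho rho').
intros r; cbn [sat].
rewrite (@sat_mix_ren p _ _ _ r rho), (@sat_mix_ren q _ _ _ r rho');
  [rewrite H, H'; tauto|intros i; rewrite ?mix_odd, ?mix_even, ?mix_odd; reflexivity ..].
Qed.

Lemma Def_all (Q : (nat -> M) -> M -> Prop) :
  Def (fun r => Q (fun n => r (S n)) (r 0)) -> Def (fun r => forall x, Q r x).
Proof.
intros [p [rho H]].
(* Under the quantifier the bound variable has index 0, so every entry of [mix r rho] moves up by
   one. *)
set (q := rename (mix_ren (fun i => match i with 0 => 0 | S i => S (2 * i) end)
                          (fun i => S (S (2 * i)))) p).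
exists (fAll q), rho; intros r; cbn [sat].
assert (E : forall x, sat (scons x (mix r rho)) q <-> Q r x).
{ intros x; unfold q; rewrite (@sat_mix_ren p _ _ _ (scons x r) rho).
  - apply (H (scons x r)).
  - intros [|i]; cbn [scons]; [reflexivity|apply mix_even].
  - intros i; cbn [scons]; apply mix_odd. }
split; intros A x; apply E, A.
Qed.

Lemma Def_rename f P : Def P -> Def (fun r => P (fun n => r (f n))).
Proof.
intros [p [rho H]].
exists (rename (mix_ren (fun i => 2 * f i) (fun i => S (2 * i))) p), rho.
intros r; rewrite (@sat_mix_ren p _ _ _ (fun n => r (f n)) rho); [apply H| |];
  intros i; [apply mix_even|apply mix_odd].
Qed.

Lemma Def_shift P : Def P -> Def (fun r => P (fun n => r (S n))).
Proof. apply (@Def_rename S). Qed.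

Hypothesis inh : inhabited M.

(** A proposition that ignores the assignment has a fixed truth value, so one of two closed formulas
    expresses it, even if [P] itself is not first-order. *)
Lemma Def_const (P : Prop) : Def (fun _ => P).
Proof.
destruct inh as [a]; destruct (classic P) as [H|H].
- exists (fImp fBot fBot), (fun _ => a); simpl; tauto.
- exists fBot, (fun _ => a); simpl; tauto.
Qed.

Lemma Def_not P : Def P -> Def (fun r => ~ P r).
Proof. intros H; exact (Def_imp H (Def_const False)). Qed.

Lemma Def_or P Q : Def P -> Def Q -> Def (fun r => P r \/ Q r).
Proof.
intros H H'; apply (@Def_ext (fun r => ~ P r -> Q r)); [intros r; tauto|].
apply Def_imp; [apply Def_not|]; assumption.
Qed.

Lemma Def_and P Q : Def P -> Def Q -> Def (fun r => P r /\ Q r).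
Proof.
intros H H'; apply (@Def_ext (fun r => ~ (P r -> ~ Q r))); [intros r; tauto|].
apply Def_not, Def_imp; [|apply Def_not]; assumption.
Qed.

Lemma Def_iff P Q : Def P -> Def Q -> Def (fun r => P r <-> Q r).
Proof. intros H H'; apply Def_and; apply Def_imp; assumption. Qed.

Lemma Def_ex (Q : (nat -> M) -> M -> Prop) :
  Def (fun r => Q (fun n => r (S n)) (r 0)) -> Def (fun r => exists x, Q r x).
Proof.
intros H; apply (@Def_ext (fun r => ~ forall x, ~ Q r x)).
- intros r; split; [apply not_all_not_ex|intros [x Hx] A; apply (A x Hx)].
- apply Def_not, Def_all, Def_not, H.
Qed.

Lemma DefTerm_shift t : DefTerm t -> DefTerm (fun r => t (fun n => r (S n))).
Proof.
intros H; unfold DefTerm in *.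
exact (@Def_rename (fun n => match n with 0 => 0 | S n => S (S n) end) _ H).
Qed.

Lemma DefTerm_var i : DefTerm (fun r => r i).
Proof.
destruct inh as [a].
exists (fEq (2 * 0) (2 * (S i))), (fun _ => a).
intros r; cbn [sat]; rewrite !mix_even; tauto.
Qed.

Lemma DefTerm_const a : DefTerm (fun _ => a).
Proof.
exists (fEq (2 * 0) (S (2 * 0))), (fun _ => a).
intros r; cbn [sat]; rewrite mix_even, mix_odd; tauto.
Qed.

(** Substitution is replaced by an existential quantifier over the value of [t], so formulas need no
    terms. *)
Lemma Def_subst t (P : (nat -> M) -> M -> Prop) :
  DefTerm t -> Def (fun r => P (fun n => r (S n)) (r 0)) -> Def (fun r => P r (t r)).
Proof.
intros Ht H; apply (@Def_ext (fun r => exists x, x = t r /\ P r x)).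
- intros r; split; [intros [x [-> Hx]]; exact Hx|intros Hx; exists (t r); auto].
- apply Def_ex, Def_and; [exact Ht|exact H].
Qed.

Lemma Def_subst2 t u (P : M -> M -> Prop) :
  Def (fun r => P (r 0) (r 1)) -> DefTerm t -> DefTerm u -> Def (fun r => P (t r) (u r)).
Proof.
intros H Ht Hu; apply (@Def_subst t (fun r x => P x (u r))); [exact Ht|].
apply (@Def_subst _ (fun r y => P (r 0) y)); [apply (DefTerm_shift Hu)|].
exact (@Def_rename (fun n => match n with 0 => 1 | _ => 0 end) _ H).
Qed.

Lemma Def_mem t u : DefTerm t -> DefTerm u -> Def (fun r => t r ∈ u r).
Proof.
destruct inh as [a]; apply Def_subst2.
exists (fMem (2 * 0) (2 * 1)), (fun _ => a).
intros r; cbn [sat]; rewrite !mix_even; tauto.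
Qed.

Lemma Def_eq t u : DefTerm t -> DefTerm u -> Def (fun r => t r = u r).
Proof.
destruct inh as [a]; apply (@Def_subst2 _ _ (fun x y => x = y)).
exists (fEq (2 * 0) (2 * 1)), (fun _ => a).
intros r; cbn [sat]; rewrite !mix_even; tauto.
Qed.

Lemma Def_subst1 t (P : M -> Prop) :
  Def (fun r => P (r 0)) -> DefTerm t -> Def (fun r => P (t r)).
Proof.
intros H Ht; apply (@Def_subst t (fun _ x => P x)); assumption.
Qed.

Lemma Def_subst3 t u v (P : M -> M -> M -> Prop) :
  Def (fun r => P (r 0) (r 1) (r 2)) -> DefTerm t -> DefTerm u -> DefTerm v ->
  Def (fun r => P (t r) (u r) (v r)).
Proof.
intros H Ht Hu Hv; apply (@Def_subst t (fun r x => P x (u r) (v r))); [exact Ht|].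
apply (@Def_subst _ (fun r y => P (r 0) y (v (fun n => r (S n)))));
  [apply (DefTerm_shift Hu)|].
apply (@Def_subst _ (fun r z => P (r 1) (r 0) z));
  [apply (DefTerm_shift (DefTerm_shift Hv))|].
exact (@Def_rename (fun n => match n with 0 => 2 | 1 => 1 | _ => 0 end) _ H).
Qed.

Lemma DefTerm_subst1 t (F : M -> M) :
  DefTerm (fun r => F (r 0)) -> DefTerm t -> DefTerm (fun r => F (t r)).
Proof.
intros H Ht; apply (@Def_subst2 _ _ (fun z x => z = F x)); [exact H| |].
- apply DefTerm_var.
- apply DefTerm_shift, Ht.
Qed.

Lemma DefTerm_subst2 t u (F : M -> M -> M) :
  DefTerm (fun r => F (r 0) (r 1)) -> DefTerm t -> DefTerm u ->
  DefTerm (fun r => F (t r) (u r)).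
Proof.
intros H Ht Hu; apply (@Def_subst3 _ _ _ (fun z x y => z = F x y)); [exact H| | |].
- apply DefTerm_var.
- apply DefTerm_shift, Ht.
- apply DefTerm_shift, Hu.
Qed.

End Definability.

(** * Definite descriptions and pairs *)

Section Basics.
Context {M : structure} {hZF : ZF M}.

Lemma model_inhabited : inhabited M.
Proof. destruct (zf_infinity hZF) as [w _]; exact (inhabits w). Qed.

Lemma empty_exists : exists e : M, is_empty e.
Proof. destruct (zf_infinity hZF) as [w [[e [He _]] _]]; exists e; exact He. Qed.

Definition emp : M := proj1_sig (constructive_indefinite_description _ empty_exists).

Lemma emp_spec : is_empty emp.
Proof. exact (proj2_sig (constructive_indefinite_description _ empty_exists)). Qed.

(* The empty set is the junk value, so that the graph of a description is
   first-order definable. *)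
Definition desc (P : M -> Prop) : M :=
  match excluded_middle_informative (exists! y, P y) with
  | left H => proj1_sig (constructive_indefinite_description _ H)
  | right _ => emp
  end.

Lemma desc_spec (P : M -> Prop) : (exists! y, P y) -> P (desc P).
Proof.
intros H; unfold desc; destruct excluded_middle_informative as [H'|H']; [|tauto].
exact (proj1 (proj2_sig (constructive_indefinite_description _ H'))).
Qed.

Lemma desc_eq (P : M -> Prop) y : P y -> (forall z, P z -> z = y) -> desc P = y.
Proof.
intros H H'; apply H', desc_spec; exists y; split; [exact H|].
intros z Hz; symmetry; auto.
Qed.

Definition ifp (P : Prop) (x y : M) : M := if excluded_middle_informative P then x else y.

Lemma ifp_true (P : Prop) x y : P -> ifp P x y = x.
Proof. unfold ifp; destruct excluded_middle_informative; tauto. Qed.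

Lemma ifp_false (P : Prop) x y : ~ P -> ifp P x y = y.
Proof. unfold ifp; destruct excluded_middle_informative; tauto. Qed.

(** The graph is a disjunction: the value is the only witness, or there is no unique witness and the
    value is the parameter [emp]. *)
Lemma DefTerm_desc (P : (nat -> M) -> M -> Prop) :
  Def (fun r => P (fun n => r (S n)) (r 0)) -> DefTerm (fun r => desc (P r)).
Proof.
intros H; pose proof model_inhabited as I.
apply (@Def_ext M (fun r =>
  (P (fun n => r (S n)) (r 0) /\ forall y, P (fun n => r (S n)) y -> y = r 0) \/
  (~ (exists y, P (fun n => r (S n)) y /\ forall z, P (fun n => r (S n)) z -> z = y) /\
   r 0 = emp))).
- intros r; split.
  + intros [[A B]|[A ->]]; [symmetry; apply desc_eq; auto|].
    unfold desc; destruct excluded_middle_informative as [[y [Hy Hy']]|_]; [|reflexivity].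
    exfalso; apply A; exists y; split; [exact Hy|intros z Hz; symmetry; auto].
  + intros E; destruct (classic (exists! y, P (fun n => r (S n)) y)) as [[y [Hy Hy']]|N].
    * left. rewrite (desc_eq Hy) in E by (intros z Hz; symmetry; auto).
      rewrite E; split; [exact Hy|intros z Hz; symmetry; auto].
    * right; split.
      -- intros [y [Hy Hy']]; apply N; exists y; split; [exact Hy|intros z Hz; symmetry; auto].
      -- rewrite E; unfold desc; destruct excluded_middle_informative; tauto.
- apply Def_or; [exact I| |].
  + apply Def_and; [exact I|exact H|].
    apply Def_all, Def_imp; [|apply Def_eq; try exact I; apply DefTerm_var, I].
    exact (@Def_rename M (fun n => match n with 0 => 0 | S n => S (S n) end) _ H).
  + apply Def_and; [exact I| |apply Def_eq; [exact I|apply DefTerm_var, I|apply DefTerm_const]].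
    apply Def_not, Def_ex, Def_and; try exact I.
    * exact (@Def_rename M (fun n => match n with 0 => 0 | S n => S (S n) end) _ H).
    * apply Def_all, Def_imp; [|apply Def_eq; try exact I; apply DefTerm_var, I].
      exact (@Def_rename M (fun n => match n with 0 => 0 | S n => S (S (S n)) end) _ H).
Qed.

Lemma DefTerm_ifp (P : (nat -> M) -> Prop) t u :
  Def P -> DefTerm t -> DefTerm u -> DefTerm (fun r => ifp (P r) (t r) (u r)).
Proof.
intros H Ht Hu; pose proof model_inhabited as I.
apply (@Def_ext M (fun r => (P (fun n => r (S n)) /\ r 0 = t (fun n => r (S n))) \/
                           (~ P (fun n => r (S n)) /\ r 0 = u (fun n => r (S n))))).
- intros r; destruct (classic (P (fun n => r (S n)))) as [A|A];
    [rewrite (ifp_true _ _ A)|rewrite (ifp_false _ _ A)]; tauto.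
- apply Def_or; [exact I| |]; apply Def_and; try exact I;
    [apply Def_shift, H|exact Ht|apply Def_not, Def_shift, H; exact I|exact Hu].
Qed.

End Basics.

(** * Automated proofs of definability *)

Ltac dfn_hook := fail.

Ltac head_of t := lazymatch t with ?f _ => head_of f | _ => t end.

Ltac dfn_unfold P :=
  lazymatch P with
  | fun r : ?E => _ =>
    let t := constr:(fun r : E =>
      ltac:(let u := eval cbv beta in (P r) in let h := head_of u in exact h)) in
    lazymatch t with fun _ => ?h => unfold h end
  end.

(** Recursion on the shape of the predicate or term. Definability hypotheses of the context come
    first, then parts free of variables, then logical structure, then [dfn_hook]; the last resort is
    to unfold the head symbol. *)
Ltac dfn :=
  cbv beta;
  first
  [ exact model_inhabited
  | match goal with
    | D : Def (fun r => ?P (r 0)) |- Def (fun r => ?P (@?t r)) =>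
      apply (@Def_subst1 _ model_inhabited t P D)
    | D : Def (fun r => ?P (r 0) (r 1)) |- Def (fun r => ?P (@?t r) (@?u r)) =>
      apply (@Def_subst2 _ model_inhabited t u P D)
    | D : DefTerm (fun r => ?F (r 0)) |- DefTerm (fun r => ?F (@?t r)) =>
      apply (@DefTerm_subst1 _ model_inhabited t F D)
    | D : DefTerm (fun r => ?F (r 0) (r 1)) |- DefTerm (fun r => ?F (@?t r) (@?u r)) =>
      apply (@DefTerm_subst2 _ model_inhabited t u F D)
    end; dfn
  | apply Def_const; exact model_inhabited
  | apply DefTerm_const
  | lazymatch goal with
    | |- Def (fun r => @?P r /\ @?Q r) => apply (@Def_and _ model_inhabited P Q)
    | |- Def (fun r => @?P r \/ @?Q r) => apply (@Def_or _ model_inhabited P Q)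
    | |- Def (fun r => ~ @?P r) => apply (@Def_not _ model_inhabited P)
    | |- Def (fun r => @?P r <-> @?Q r) => apply (@Def_iff _ model_inhabited P Q)
    | |- Def (fun r => @?P r -> @?Q r) => apply (@Def_imp _ P Q)
    | |- Def (fun r => forall x : _, @?Q r x) => apply (@Def_all _ Q)
    | |- Def (fun r => @ex _ (@?Q r)) => apply (@Def_ex _ model_inhabited Q)
    | |- Def (fun r => mem (@?t r) (@?u r)) => apply (@Def_mem _ model_inhabited t u)
    | |- Def (fun r => @?t r = @?u r) => apply (@Def_eq _ model_inhabited t u)
    | |- DefTerm (fun r => r _) => apply DefTerm_var
    | |- DefTerm (fun r => desc (@?P r)) => apply (@DefTerm_desc _ _ P)
    | |- DefTerm (fun r => ifp (@?P r) (@?t r) (@?u r)) => apply (@DefTerm_ifp _ _ P t u)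
    end; dfn
  | dfn_hook; dfn
  | lazymatch goal with
    | |- Def ?P => dfn_unfold P; dfn
    | |- DefTerm ?P => dfn_unfold P; dfn
    end ].

(** * Separation and replacement for definable predicates, and ordered pairs *)

Section Basics2.
Context {M : structure} {hZF : ZF M}.
Implicit Types x y z : M.

Lemma sep (P : M -> Prop) (x : M) :
  Def (fun r => P (r 0)) -> exists y, forall z, z ∈ y <-> z ∈ x /\ P z.
Proof.
intros [p [rho H]].
(* Since [P] looks at [r 0] only, all free variables may share index 0; the parameters start at
   index 1. *)
set (q := rename (mix_ren (fun _ => 0) S) p).
destruct (zf_separation hZF q rho x) as [y Hy]; exists y; intros z.
rewrite (Hy z). unfold q.
rewrite (@sat_mix_ren _ p _ _ _ (fun _ => z) rho); [rewrite (H (fun _ => z)); tauto| |]; reflexivity.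
Qed.

Lemma replacement (P : M -> M -> Prop) (x : M) :
  Def (fun r => P (r 0) (r 1)) ->
  (forall u v v', u ∈ x -> P u v -> P u v' -> v = v') ->
  exists y, forall v, v ∈ y <-> exists u, u ∈ x /\ P u v.
Proof.
intros [p [rho H]] F.
set (q := rename (mix_ren (fun i => match i with 0 => 0 | _ => 1 end) (fun i => S (S i))) p).
assert (E : forall u v, sat (scons u (scons v rho)) q <-> P u v).
{ intros u v; unfold q.
  rewrite (@sat_mix_ren _ p _ _ _ (fun n => match n with 0 => u | _ => v end) rho);
   [rewrite H; tauto|intros [|i]; reflexivity|reflexivity]. }
destruct (@zf_replacement _ hZF q rho x) as [y Hy].
- intros u v v' Hu A B; apply (F u); auto; apply E; assumption.
- exists y; intros v; rewrite (Hy v); split; intros [u [Hu A]]; exists u; split; auto; apply E, A.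
Qed.

Lemma ext (x y : M) : (forall z, z ∈ x <-> z ∈ y) -> x = y.
Proof. apply (zf_extensionality hZF). Qed.

Lemma upair_unique (p q x y : M) : is_upair p x y -> is_upair q x y -> p = q.
Proof. intros A B; apply ext; intros z; rewrite (A z), (B z); tauto. Qed.

Lemma upair_inj (p x y x' y' : M) : is_upair p x y -> is_upair p x' y' ->
  (x = x' /\ y = y') \/ (x = y' /\ y = x').
Proof.
intros A B.
assert (x = x' \/ x = y') by (apply B, A; auto).
assert (y = x' \/ y = y') by (apply B, A; auto).
assert (x' = x \/ x' = y) by (apply A, B; auto).
assert (y' = x \/ y' = y) by (apply A, B; auto).
intuition congruence.
Qed.

Lemma opair_exists x y : exists p : M, is_opair p x y.
Proof.
destruct (zf_pairing hZF x x) as [a Ha], (zf_pairing hZF x y) as [b Hb].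
destruct (zf_pairing hZF a b) as [p Hp]; exists p, a, b; auto.
Qed.

Lemma opair_unique (p q x y : M) : is_opair p x y -> is_opair q x y -> p = q.
Proof.
intros [a [b [A [B C]]]] [a' [b' [A' [B' C']]]].
rewrite (upair_unique A' A), (upair_unique B' B) in C'; apply (upair_unique C C').
Qed.

Lemma opair_inj (p x y x' y' : M) : is_opair p x y -> is_opair p x' y' -> x = x' /\ y = y'.
Proof.
intros [a [b [A [B C]]]] [a' [b' [A' [B' C']]]].
destruct (upair_inj C C') as [[<- <-]|[<- <-]].
- pose proof (upair_inj A A'); pose proof (upair_inj B B'); intuition congruence.
- pose proof (upair_inj A B'); pose proof (upair_inj B A'); intuition congruence.
Qed.

Definition pr x y : M := desc (fun p => is_opair p x y).

Lemma pr_spec x y : is_opair (pr x y) x y.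
Proof.
apply (@desc_spec _ _ (fun p => is_opair p x y)); destruct (opair_exists x y) as [p Hp]; exists p; split; [exact Hp|].
intros q Hq; apply (opair_unique Hp Hq).
Qed.

Lemma opairE p x y : is_opair p x y <-> p = pr x y.
Proof.
split; [intros H; apply (opair_unique H), pr_spec|intros ->; apply pr_spec].
Qed.

Lemma pr_inj x y x' y' : pr x y = pr x' y' -> x = x' /\ y = y'.
Proof. intros E; apply (opair_inj (p := pr x y)); [|rewrite E]; apply pr_spec. Qed.

Definition pfst (p : M) : M := desc (fun x => exists y, p = pr x y).
Definition psnd (p : M) : M := desc (fun y => exists x, p = pr x y).

Lemma fst_pr x y : pfst (pr x y) = x.
Proof.
apply desc_eq; [eauto|intros z [y' E]]; apply pr_inj in E; symmetry; apply E.
Qed.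

Lemma snd_pr x y : psnd (pr x y) = y.
Proof.
apply desc_eq; [eauto|intros z [y' E]]; apply pr_inj in E; symmetry; apply E.
Qed.

Lemma appE (f x y : M) : app f x y <-> pr x y ∈ f.
Proof.
split.
- intros [p [Hp H]]; apply opairE in Hp; congruence.
- intros H; exists (pr x y); split; [apply pr_spec|exact H].
Qed.

Lemma DefTerm_pr (t u : (nat -> M) -> M) :
  DefTerm t -> DefTerm u -> DefTerm (fun r => pr (t r) (u r)).
Proof.
apply DefTerm_subst2; unfold pr; dfn.
Qed.

Lemma DefTerm_fst (t : (nat -> M) -> M) : DefTerm t -> DefTerm (fun r => pfst (t r)).
Proof. apply DefTerm_subst1; unfold pfst; dfn. Qed.

End Basics2.

(** * Sets, ordinals and ω *)

Section Symbols.
Context {M : structure} {hZF : ZF M}.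

Definition succ (x : M) : M := desc (fun s => is_succ s x).
Definition ap (f x : M) : M := desc (fun y => app f x y).

Lemma DefTerm_snd (t : (nat -> M) -> M) : DefTerm t -> DefTerm (fun r => psnd (t r)).
Proof. apply DefTerm_subst1; unfold psnd; dfn. Qed.

Lemma DefTerm_succ (t : (nat -> M) -> M) : DefTerm t -> DefTerm (fun r => succ (t r)).
Proof. apply DefTerm_subst1; unfold succ; dfn. Qed.

Lemma DefTerm_ap (t u : (nat -> M) -> M) :
  DefTerm t -> DefTerm u -> DefTerm (fun r => ap (t r) (u r)).
Proof. apply DefTerm_subst2; unfold ap; dfn. Qed.

End Symbols.

Ltac dfn_hook ::=
  first [apply DefTerm_pr | apply DefTerm_fst | apply DefTerm_snd
        | apply DefTerm_succ | apply DefTerm_ap].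

Section Sets.
Context {M : structure} {hZF : ZF M}.
Implicit Types x y z : M.

Lemma succE x z : z ∈ succ x <-> z ∈ x \/ z = x.
Proof.
unfold succ; apply (@desc_spec _ _ (fun s => is_succ s x)).
destruct (zf_pairing hZF x x) as [a Ha], (zf_pairing hZF x a) as [b Hb].
destruct (zf_union hZF b) as [s Hs]; exists s.
assert (H : is_succ s x).
{ intros u; rewrite (Hs u); split.
  - intros [y [Hy Hu]]; apply Hb in Hy; destruct Hy as [->| ->]; [auto|].
    apply Ha in Hu; tauto.
  - intros [Hu| ->]; [exists x|exists a]; split; try assumption; try apply Hb; auto.
    apply Ha; auto. }
split; [exact H|].
intros t Ht; apply ext; intros u; rewrite (H u), (Ht u); tauto.
Qed.

Lemma is_succE s x : is_succ s x <-> s = succ x.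
Proof.
split.
- intros H; apply ext; intros z; rewrite (H z), succE; tauto.
- intros ->; intros z; apply succE.
Qed.

Lemma emptyE x : is_empty x <-> x = emp.
Proof.
split; [|intros ->; apply emp_spec].
intros H; apply ext; intros z; split; intros Hz; exfalso; [apply (H z Hz)|apply (emp_spec Hz)].
Qed.

(** All pairs concerned lie in the double power set of the union of [A] and [B], from which
    separation cuts out the product. *)
Lemma product_exists (A B : M) : exists P, is_product P A B.
Proof.
destruct (zf_pairing hZF A B) as [ab Hab], (zf_union hZF ab) as [u Hu].
destruct (zf_power hZF u) as [pu Hpu], (zf_power hZF pu) as [ppu Hppu].
destruct (@sep M hZF (fun q => exists a b, a ∈ A /\ b ∈ B /\ is_opair q a b) ppu) as [P HP];
  [dfn|].
exists P; intros q; rewrite (HP q); split; [tauto|].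
intros H; split; [|exact H].
destruct H as [a [b [Ha [Hb [c [d [Hc [Hd Hq]]]]]]]].
assert (Ua : a ∈ u) by (apply Hu; exists A; split; [apply Hab|]; auto).
assert (Ub : b ∈ u) by (apply Hu; exists B; split; [apply Hab|]; auto).
apply Hppu; intros z Hz; apply Hpu; intros t Ht; apply Hq in Hz.
destruct Hz as [-> | ->]; [apply Hc in Ht|apply Hd in Ht]; destruct Ht as [-> | ->]; assumption.
Qed.

Lemma productE P A B x y : is_product P A B -> (pr x y ∈ P <-> x ∈ A /\ y ∈ B).
Proof.
intros H; rewrite (H (pr x y)); split.
- intros [a [b [Ha [Hb E]]]]; apply opairE, pr_inj in E; destruct E as [-> ->]; auto.
- intros [Hx Hy]; exists x, y; split; [exact Hx|split; [exact Hy|apply pr_spec]].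
Qed.

Lemma product_elim P A B p : is_product P A B -> p ∈ P ->
  exists x y, x ∈ A /\ y ∈ B /\ p = pr x y.
Proof.
intros H Hp; apply H in Hp; destruct Hp as [a [b [Ha [Hb E]]]].
apply opairE in E; eauto.
Qed.

Lemma rel_exists (A B : M) (P : M -> M -> Prop) : Def (fun r => P (r 0) (r 1)) ->
  exists f, is_relation f A B /\
    forall x y, pr x y ∈ f <-> x ∈ A /\ y ∈ B /\ P x y.
Proof.
intros D; destruct (product_exists A B) as [Q HQ].
destruct (@sep M hZF (fun q => exists x y, q = pr x y /\ P x y) Q) as [f Hf].
{ dfn. }
exists f; split.
- intros p Hp; apply HQ, Hf, Hp.
- intros x y; rewrite (Hf (pr x y)), (productE x y HQ); split.
  + intros [[Hx Hy] [x' [y' [E H]]]]; apply pr_inj in E; destruct E as [-> ->]; auto.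
  + intros [Hx [Hy H]]; split; [|exists x, y]; auto.
Qed.

Lemma fun_exists (A B : M) (P : M -> M -> Prop) : Def (fun r => P (r 0) (r 1)) ->
  (forall x, x ∈ A -> exists y, y ∈ B /\ P x y) ->
  (forall x y y', x ∈ A -> P x y -> P x y' -> y = y') ->
  exists f, is_function f A B /\
    forall x y, pr x y ∈ f <-> x ∈ A /\ y ∈ B /\ P x y.
Proof.
intros D E U; destruct (rel_exists A B D) as [f [Hf H]].
exists f; split; [split; [exact Hf|]|exact H].
intros x Hx; destruct (E x Hx) as [y [Hy Hxy]]; exists y; split.
- apply appE, H; auto.
- intros y' Hy'; apply appE, H in Hy'; apply (U x); tauto.
Qed.

Lemma apE f A B x y : is_function f A B -> x ∈ A -> (app f x y <-> y = ap f x).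
Proof.
intros [Hf F] Hx; destruct (F x Hx) as [z [Hz U]].
assert (E : ap f x = z) by (apply desc_eq; [exact Hz|intros; symmetry; auto]).
rewrite E; split; [intros H; symmetry; auto|intros ->; exact Hz].
Qed.

Lemma app_in f A B x y : is_function f A B -> app f x y -> x ∈ A /\ y ∈ B.
Proof.
intros [Hf _] H; apply appE, Hf in H; destruct H as [a [b [Ha [Hb E]]]].
apply opairE, pr_inj in E; destruct E as [-> ->]; auto.
Qed.

Lemma ap_in f A B x : is_function f A B -> x ∈ A -> ap f x ∈ B.
Proof.
intros Hf Hx; apply (app_in (x := x) Hf), (apE _ Hf Hx); reflexivity.
Qed.

(** Foundation applied to the separated subset of [x]. It serves below to pick least ordinals and
    least natural numbers without choice. *)
Lemma foundation_sep (x : M) (P : M -> Prop) : Def (fun r => P (r 0)) ->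
  (exists y, y ∈ x /\ P y) ->
  exists y, y ∈ x /\ P y /\ forall z, z ∈ x -> z ∈ y -> ~ P z.
Proof.
intros D [y0 [Hy0 Py0]]; destruct (@sep M hZF P x D) as [s Hs].
destruct (zf_foundation hZF (x := s)) as [y [Hy Hm]]; [exists y0; apply Hs; auto|].
exists y; apply Hs in Hy; destruct Hy as [Hy Py]; split; [exact Hy|split; [exact Py|]].
intros z Hz Hzy Pz; apply (Hm z); [apply Hs|]; auto.
Qed.

Lemma mem_ind_on (x : M) (P : M -> Prop) : Def (fun r => P (r 0)) ->
  (forall y, y ∈ x -> (forall z, z ∈ x -> z ∈ y -> P z) -> P y) ->
  forall y, y ∈ x -> P y.
Proof.
intros D H y Hy; apply NNPP; intros N.
destruct (@foundation_sep x (fun z => ~ P z)) as [m [Hm [Nm Mm]]];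
  [apply Def_not; [exact model_inhabited|exact D]|exists y; auto|].
apply Nm, H; [exact Hm|]; intros z Hz Hzm; apply NNPP; apply (Mm z Hz Hzm).
Qed.

Lemma no_cycle3 x y z : x ∈ y -> y ∈ z -> z ∈ x -> False.
Proof.
intros A B C.
destruct (zf_pairing hZF x y) as [p Hp], (zf_pairing hZF z z) as [q Hq].
destruct (zf_pairing hZF p q) as [pq Hpq], (zf_union hZF pq) as [u Hu].
assert (E : forall t, t ∈ u <-> t = x \/ t = y \/ t = z).
{ intros t; rewrite (Hu t); split.
  - intros [v [Hv Ht]]; apply Hpq in Hv; destruct Hv as [-> | ->];
      [apply Hp in Ht|apply Hq in Ht]; tauto.
  - intros [H|[H|H]]; [exists p|exists p|exists q]; split;
      first [apply Hpq; auto|apply Hp; auto|apply Hq; auto]. }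
destruct (zf_foundation hZF (x := u)) as [m [Hm Mm]]; [exists x; apply E; auto|].
apply E in Hm; destruct Hm as [-> | [-> | ->]];
  [apply (Mm z)|apply (Mm x)|apply (Mm y)]; try assumption; apply E; auto.
Qed.

Lemma mem_irrefl x : x ∉ x.
Proof. intros H; exact (no_cycle3 H H H). Qed.

Lemma mem_asym x y : x ∈ y -> y ∉ x.
Proof.
intros H H'. destruct (zf_pairing hZF x y) as [u E].
destruct (zf_foundation hZF (x := u)) as [m [Hm Mm]]; [exists x; apply E; auto|].
apply E in Hm; destruct Hm as [-> | ->];
  [apply (Mm y)|apply (Mm x)]; try assumption; apply E; auto.
Qed.

(** Foundation supplies the rest of a well-order: there are no membership cycles of length at most
    three, and a minimal element is least once membership is total. *)
Lemma ordinalE (a : M) : is_ordinal a <->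
  transitive a /\ (forall x y, x ∈ a -> y ∈ a -> x ∈ y \/ x = y \/ y ∈ x).
Proof.
split.
- intros [T [_ [_ [C _]]]]; auto.
- intros [T C]; split; [exact T|split; [|split; [|split]]].
  + intros x _; apply mem_irrefl.
  + intros x y z Hx Hy Hz A B; destruct (C x z Hx Hz) as [H|[->|H]]; [exact H| |].
    * exfalso; exact (mem_asym A B).
    * exfalso; exact (no_cycle3 A B H).
  + exact C.
  + intros s Hs N; destruct (zf_foundation hZF (x := s) N) as [m [Hm Mm]].
    exists m; split; [exact Hm|]; intros x Hx.
    destruct (C m x) as [H|[H|H]]; auto; exfalso; exact (Mm x Hx H).
Qed.

Lemma ordinal_mem (a b : M) : is_ordinal a -> b ∈ a -> is_ordinal b.
Proof.
intros Ha Hb; apply ordinalE in Ha; destruct Ha as [T C]; apply ordinalE; split.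
- intros c Hc d Hd; assert (Ca : c ∈ a) by exact (T b Hb c Hc).
  assert (Da : d ∈ a) by exact (T c Ca d Hd).
  destruct (C d b Da Hb) as [H|[H|H]]; [exact H| |].
  + subst d; exfalso; exact (mem_asym Hc Hd).
  + exfalso; exact (no_cycle3 H Hd Hc).
- intros x y Hx Hy; apply C; apply (T b Hb); assumption.
Qed.

Lemma ordinal_transitive (a b c : M) : is_ordinal a -> b ∈ a -> c ∈ b -> c ∈ a.
Proof. intros [T _] Hb Hc; exact (T b Hb c Hc). Qed.

(** A minimal element [m] of [a] outside [d] equals [d]: minimality puts the elements of [m] into
    [d], and transitivity of [d] with totality in [a] gives the converse. *)
Lemma transitive_proper_subset (a d : M) :
  is_ordinal a -> transitive d -> subset d a -> d <> a -> d ∈ a.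
Proof.
intros Ha Td S N; apply ordinalE in Ha; destruct Ha as [T C].
destruct (@foundation_sep a (fun x => x ∉ d)) as [m [Hm [Nm Mm]]]; [dfn| |].
- apply NNPP; intros H; apply N, ext; intros z; split; [apply S|].
  intros Hz; apply NNPP; intros Hd; apply H; eauto.
- replace d with m; [exact Hm|]; apply ext; intros x; split; intros Hx.
  + apply NNPP; intros Hd; exact (Mm x (T m Hm x Hx) Hx Hd).
  + destruct (C x m (S x Hx) Hm) as [H|[->|H]]; [exact H|tauto|].
    exfalso; exact (Nm (Td x Hx m H)).
Qed.

(** The intersection [d] of [a] and [b] is transitive. If it differed from both, it would belong to
    both, hence to itself. *)
Lemma ordinal_total (a b : M) : is_ordinal a -> is_ordinal b -> a ∈ b \/ a = b \/ b ∈ a.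
Proof.
intros Ha Hb; destruct (@sep M hZF (fun x => x ∈ b) a) as [d Hd]; [dfn|].
assert (Td : transitive d).
{ intros y Hy z Hz; apply Hd in Hy; apply Hd; destruct Hy as [Ya Yb]; split.
  - exact (ordinal_transitive Ha Ya Hz).
  - exact (ordinal_transitive Hb Yb Hz). }
assert (Sa : subset d a) by (intros z Hz; apply Hd, Hz).
assert (Sb : subset d b) by (intros z Hz; apply Hd, Hz).
destruct (classic (d = a)) as [Ea|Na], (classic (d = b)) as [Eb|Nb].
- right; left; congruence.
- left; rewrite Ea in *; apply transitive_proper_subset; auto.
- right; right; rewrite Eb in *; apply transitive_proper_subset; auto.
- exfalso; apply (@mem_irrefl d), Hd; split; apply transitive_proper_subset; auto.
Qed.

Lemma ordinal_emp : is_ordinal (@emp M hZF).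
Proof.
apply ordinalE; split; [intros x Hx|intros x y Hx]; exfalso; exact (emp_spec Hx).
Qed.

Lemma ordinal_succ (a : M) : is_ordinal a -> is_ordinal (succ a).
Proof.
intros Ha; apply ordinalE; split.
- intros x Hx z Hz; apply succE; left; apply succE in Hx; destruct Hx as [Hx| ->];
    [exact (ordinal_transitive Ha Hx Hz)|exact Hz].
- assert (H : forall x, x ∈ succ a -> is_ordinal x).
  { intros x Hx; apply succE in Hx; destruct Hx as [Hx| ->]; [exact (ordinal_mem Ha Hx)|exact Ha]. }
  intros x y Hx Hy; apply ordinal_total; auto.
Qed.

Variable w : M.
Hypothesis hw : is_omega w.

Lemma inductiveE (i : M) : inductive i <-> emp ∈ i /\ forall n, n ∈ i -> succ n ∈ i.
Proof.
split.
- intros [[e [He Hi]] S]; split; [apply emptyE in He; congruence|].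
  intros n Hn; destruct (S n Hn) as [s [Hs H]]; apply is_succE in Hs; congruence.
- intros [E S]; split; [exists emp; split; [apply emp_spec|exact E]|].
  intros n Hn; exists (succ n); split; [apply is_succE; reflexivity|auto].
Qed.

Lemma omega_emp : emp ∈ w.
Proof. apply inductiveE, hw. Qed.

Lemma omega_succ n : n ∈ w -> succ n ∈ w.
Proof. apply inductiveE, hw. Qed.

Lemma omega_ind (P : M -> Prop) : Def (fun r => P (r 0)) -> P emp ->
  (forall n, n ∈ w -> P n -> P (succ n)) -> forall n, n ∈ w -> P n.
Proof.
intros D P0 PS n Hn; destruct (@sep M hZF P w D) as [s Hs].
apply Hs, (proj2 hw); [|exact Hn]; apply inductiveE; split.
- apply Hs; split; [apply omega_emp|exact P0].
- intros m Hm; apply Hs in Hm; apply Hs; split; [apply omega_succ, Hm|apply PS; apply Hm].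
Qed.

Lemma omega_unique (w' : M) : is_omega w' -> w' = w.
Proof.
intros [I J]; apply ext; intros z; split; [apply J, hw|apply (proj2 hw), I].
Qed.

Lemma omega_ordinal n : n ∈ w -> is_ordinal n.
Proof.
apply (omega_ind (P := fun n => is_ordinal n)).
- dfn.
- apply ordinal_emp.
- intros m _; apply ordinal_succ.
Qed.

Lemma omega_total m n : m ∈ w -> n ∈ w -> m ∈ n \/ m = n \/ n ∈ m.
Proof. intros Hm Hn; apply ordinal_total; apply omega_ordinal; assumption. Qed.

Lemma countableE X : countable X <-> exists f, is_function f X w /\ injective f.
Proof.
split.
- intros [w' [f [H [F I]]]]; rewrite (omega_unique H) in F; eauto.
- intros [f [F I]]; exists w, f; auto.
Qed.

(** An element may have many indices; it is sent to the least one. Thus a definable relation is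
    enough to prove countability, and no witnesses have to be chosen. *)
Lemma countable_of_enum X (S : M -> M -> Prop) : Def (fun r => S (r 0) (r 1)) ->
  (forall x, x ∈ X -> exists n, n ∈ w /\ S n x) ->
  (forall n x x', x ∈ X -> x' ∈ X -> S n x -> S n x' -> x = x') ->
  countable X.
Proof.
intros D E F; apply countableE.
destruct (@fun_exists X w (fun x n => n ∈ w /\ S n x /\ forall k, k ∈ w -> k ∈ n -> ~ S k x))
  as [f [Hf H]].
- dfn.
- intros x Hx; destruct (E x Hx) as [n0 [Hn0 Sn0]].
  destruct (@foundation_sep w (fun n => S n x)) as [n [Hn [Sn Mn]]]; [dfn|eauto|].
  exists n; auto.
- intros x n n' _ [Hn [Sn Mn]] [Hn' [Sn' Mn']].
  destruct (omega_total Hn Hn') as [A|[A|A]]; [|exact A|]; exfalso;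
    [exact (Mn' n Hn A Sn)|exact (Mn n' Hn' A Sn')].
- exists f; split; [exact Hf|]; intros x x' n A B; apply appE, H in A; apply appE, H in B.
  apply (F n); tauto.
Qed.

End Sets.

(** * Coding subsets of ω × ω by reals *)

Section Walk.
Context {M : structure} {hZF : ZF M}.
Variables w J : M.
Hypothesis hw : is_omega w.
Hypothesis hJ : is_product J w w.

(* Started at (0, 0), this runs through all pairs (m, n) with m <= n. *)
Definition nxt (p : M) : M :=
  ifp (pfst p = psnd p) (pr emp (succ (psnd p))) (pr (succ (pfst p)) (psnd p)).

Lemma nxt_diag n : nxt (pr n n) = pr emp (succ n).
Proof. unfold nxt; rewrite fst_pr, snd_pr; apply ifp_true; reflexivity. Qed.

Lemma nxt_offdiag m n : m <> n -> nxt (pr m n) = pr (succ m) n.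
Proof. intros N; unfold nxt; rewrite fst_pr, snd_pr; apply ifp_false, N. Qed.

Lemma nxt_in p : p ∈ J -> nxt p ∈ J.
Proof.
intros Hp; destruct (product_elim hJ Hp) as [m [n [Hm [Hn ->]]]].
destruct (classic (m = n)) as [<-|N]; [rewrite nxt_diag|rewrite (nxt_offdiag N)];
  apply (productE _ _ hJ); split;
  first [assumption|apply (omega_emp hw)|apply (omega_succ hw); assumption].
Qed.

(** Two nested inductions on ω replace counting steps of the walk: [row] moves along the pairs with
    second coordinate [n] up to the diagonal, and [start] passes from [(n, n)] to the beginning of
    the next row. *)
Lemma walk_ind (P : M -> Prop) : Def (fun r => P (r 0)) -> P (pr emp emp) ->
  (forall p, p ∈ J -> P p -> P (nxt p)) ->
  forall m n, m ∈ w -> n ∈ w -> m ∈ n \/ m = n -> P (pr m n).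
Proof.
intros D P0 PS.
assert (row : forall n, n ∈ w -> P (pr emp n) ->
              forall m, m ∈ w -> m ∈ n \/ m = n -> P (pr m n)).
{ intros n Hn Pn; apply (omega_ind hw (P := fun m => m ∈ n \/ m = n -> P (pr m n))); [dfn|auto|].
  intros m Hm IH H.
  assert (Hmn : m ∈ n).
  { assert (Hs : m ∈ succ m) by (apply succE; auto).
    destruct H as [H|<-]; [|exact Hs].
    exact (ordinal_transitive (omega_ordinal hw Hn) H Hs). }
  rewrite <- nxt_offdiag; [apply PS|].
  - apply (productE _ _ hJ); auto.
  - apply IH; auto.
  - intros ->; exact (mem_irrefl Hmn). }
assert (start : forall n, n ∈ w -> P (pr emp n)).
{ apply (omega_ind hw (P := fun n => P (pr emp n))); [dfn|exact P0|].
  intros n Hn IH; rewrite <- nxt_diag; apply PS; [apply (productE _ _ hJ); auto|].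
  apply row; auto. }
intros m n Hm Hn; apply row; auto.
Qed.

End Walk.

(* The intended example is U = [0,1], L0 x = x/3, L1 x = x/3 + 2/3. *)
Record cantor_system {M : structure} (U bot : M) (le : M -> M -> Prop)
    (L0 L1 : M -> M) : Prop := {
  cs_refl : forall x, x ∈ U -> le x x;
  cs_trans : forall x y z, x ∈ U -> y ∈ U -> z ∈ U -> le x y -> le y z -> le x z;
  cs_antisym : forall x y, x ∈ U -> y ∈ U -> le x y -> le y x -> x = y;
  cs_bot : bot ∈ U;
  cs_bot_le : forall x, x ∈ U -> le bot x;
  cs_lub : forall X, subset X U -> (exists x, x ∈ X) ->
    exists l, l ∈ U /\ (forall x, x ∈ X -> le x l) /\
      forall b, b ∈ U -> (forall x, x ∈ X -> le x b) -> le l b;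
  cs_L0_in : forall x, x ∈ U -> L0 x ∈ U;
  cs_L1_in : forall x, x ∈ U -> L1 x ∈ U;
  cs_L0_mono : forall x y, x ∈ U -> y ∈ U -> le x y -> le (L0 x) (L0 y);
  cs_L1_mono : forall x y, x ∈ U -> y ∈ U -> le x y -> le (L1 x) (L1 y);
  cs_L0_inj : forall x y, x ∈ U -> y ∈ U -> L0 x = L0 y -> x = y;
  cs_L1_inj : forall x y, x ∈ U -> y ∈ U -> L1 x = L1 y -> x = y;
  cs_L01 : forall x y, x ∈ U -> y ∈ U -> L0 x <> L1 y;
  cs_def_le : Def (fun r => le (r 0) (r 1));
  cs_def_L0 : DefTerm (fun r => L0 (r 0));
  cs_def_L1 : DefTerm (fun r => L1 (r 0))
}.

Section Expansion.
Context {M : structure} {hZF : ZF M}.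
Variables w J U bot : M.
Variables (le : M -> M -> Prop) (L0 L1 : M -> M).
Hypothesis hw : is_omega w.
Hypothesis hJ : is_product J w w.
Hypothesis hU : cantor_system U bot le L0 L1.

(** Kept in the context so that [dfn] can treat [le], [L0] and [L1] as definable symbols. *)
Let Dle := cs_def_le hU.
Let D0 := cs_def_L0 hU.
Let D1 := cs_def_L1 hU.

Definition digit_map (s p x : M) : M := ifp (p ∈ s) (L1 x) (L0 x).

(** [E] is a relation, possibly with several values at one pair. This makes the property stable
    under unions, and [below] is the union of all such [E]. *)
Definition postfixed (s E : M) : Prop :=
  forall p x, pr p x ∈ E ->
    p ∈ J /\ x ∈ U /\ exists y, pr (nxt p) y ∈ E /\ le x (digit_map s p y).

Definition below (s p x : M) : Prop := exists E, postfixed s E /\ pr p x ∈ E.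

(* The greatest solution of v p = digit_map s p (v (nxt p)), as in the
   Knaster-Tarski theorem. *)
Definition expansion (s p : M) : M :=
  desc (fun l => l ∈ U /\ (forall x, below s p x -> le x l) /\
    forall b, b ∈ U -> (forall x, below s p x -> le x b) -> le l b).

Lemma DefTerm_expansion : DefTerm (fun r : nat -> M => expansion (r 0) (r 1)).
Proof. dfn. Qed.

Let Dexp := DefTerm_expansion.

Lemma digit_map_in s p x : x ∈ U -> digit_map s p x ∈ U.
Proof.
intros Hx; unfold digit_map; destruct (classic (p ∈ s)) as [H|H];
  [rewrite (ifp_true _ _ H); apply (cs_L1_in hU)|rewrite (ifp_false _ _ H); apply (cs_L0_in hU)];
  exact Hx.
Qed.

Lemma digit_map_mono s p x y : x ∈ U -> y ∈ U -> le x y -> le (digit_map s p x) (digit_map s p y).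
Proof.
intros Hx Hy; unfold digit_map; destruct (classic (p ∈ s)) as [H|H];
  [rewrite !(ifp_true _ _ H); apply (cs_L1_mono hU)|rewrite !(ifp_false _ _ H); apply (cs_L0_mono hU)];
  assumption.
Qed.

Lemma expansion_lub s p : p ∈ J ->
  expansion s p ∈ U /\ (forall x, below s p x -> le x (expansion s p)) /\
  forall b, b ∈ U -> (forall x, below s p x -> le x b) -> le (expansion s p) b.
Proof.
intros Hp.
destruct (@sep M hZF (fun x => below s p x) U) as [X HX]; [dfn|].
assert (XB : forall x, below s p x -> x ∈ X).
{ intros x Hx; apply HX; split; [|exact Hx]; destruct Hx as [E [PE HE]]; apply (PE _ _ HE). }
apply (@desc_spec _ _ (fun l => l ∈ U /\ (forall x, below s p x -> le x l) /\
    forall b, b ∈ U -> (forall x, below s p x -> le x b) -> le l b)).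
destruct (cs_lub hU (X := X)) as [l [Hl [Ub Lb]]].
- intros x Hx; apply HX, Hx.
(* The relation with constant value [bot] is postfixed, so the set whose supremum is taken is
   nonempty. *)
- exists bot; apply XB.
  destruct (rel_exists J U (P := fun p x => x = bot)) as [E [_ HE]]; [dfn|].
  exists E; split; [|apply HE; split; [exact Hp|split; [apply (cs_bot hU)|reflexivity]]].
  intros q x Hq; apply HE in Hq; destruct Hq as [Hq [Hx ->]].
  split; [exact Hq|split; [exact Hx|]]; exists bot; split.
  + apply HE; split; [apply (nxt_in hw hJ), Hq|auto].
  + apply (cs_bot_le hU), digit_map_in, Hx.
- exists l; split; [split; [exact Hl|split]|].
  + intros x Hx; apply Ub, XB, Hx.
  + intros b Hb H; apply Lb; [exact Hb|]; intros x Hx; apply H, HX, Hx.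
  + intros l' [Hl' [Ub' Lb']]; apply (cs_antisym hU); auto.
    apply Lb; [exact Hl'|]; intros x Hx; apply Ub', HX, Hx.
Qed.

Lemma expansion_in s p : p ∈ J -> expansion s p ∈ U.
Proof. intros Hp; apply (expansion_lub s Hp). Qed.

(** Knaster-Tarski. By monotonicity, each value below the supremum at [q] is bounded by the
    right-hand side, which gives [up]. Applying [up] one step later shows that the right-hand sides
    form a postfixed relation, so they lie below the supremum too. *)
Lemma expansion_eq s p : p ∈ J -> expansion s p = digit_map s p (expansion s (nxt p)).
Proof.
intros Hp.
assert (N : forall q, q ∈ J -> nxt q ∈ J) by (intros q; apply (nxt_in hw hJ)).
assert (step_in : forall q, q ∈ J -> digit_map s q (expansion s (nxt q)) ∈ U).
{ intros q Hq; apply digit_map_in, expansion_in, N, Hq. }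
assert (up : forall q, q ∈ J -> le (expansion s q) (digit_map s q (expansion s (nxt q)))).
{ intros q Hq; apply (expansion_lub s Hq); [apply step_in, Hq|].
  intros x [E [PE HE]]; destruct (PE _ _ HE) as [_ [Hx [y [Hy Hxy]]]].
  assert (Uy : y ∈ U) by apply (PE _ _ Hy).
  apply (cs_trans hU) with (digit_map s q y); auto using digit_map_in.
  apply digit_map_mono; auto using expansion_in.
  apply (expansion_lub s (N q Hq)); exists E; auto. }
apply (cs_antisym hU); auto using expansion_in.
apply (expansion_lub s Hp).
destruct (rel_exists J U (P := fun p x => x = digit_map s p (expansion s (nxt p)))) as [E [_ HE]];
  [dfn|].
exists E; split; [|apply HE; auto].
intros q x Hq; apply HE in Hq; destruct Hq as [Hq [Hx ->]].
split; [exact Hq|split; [exact Hx|]]; eexists; split; [apply HE; split; [|split; [|reflexivity]]; auto|].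
apply digit_map_mono; auto using expansion_in.
Qed.

(** [L0] and [L1] are injective with disjoint images, so the value reveals both the digit and the
    tail. *)
Lemma digit_map_inj s s' p x y : x ∈ U -> y ∈ U ->
  digit_map s p x = digit_map s' p y -> (p ∈ s <-> p ∈ s') /\ x = y.
Proof.
intros Hx Hy; unfold digit_map.
destruct (classic (p ∈ s)) as [H|H], (classic (p ∈ s')) as [H'|H'];
  rewrite ?(ifp_true _ _ H), ?(ifp_true _ _ H'), ?(ifp_false _ _ H), ?(ifp_false _ _ H'); intros E.
- split; [tauto|apply (cs_L1_inj hU); auto].
- exfalso; apply (cs_L01 hU Hy Hx); auto.
- exfalso; apply (cs_L01 hU Hx Hy); auto.
- split; [tauto|apply (cs_L0_inj hU); auto].
Qed.

Definition real_of (s : M) : M := expansion s (pr emp emp).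

Lemma DefTerm_real_of : DefTerm (fun r : nat -> M => real_of (r 0)).
Proof. dfn. Qed.

Lemma real_of_in s : real_of s ∈ U.
Proof. apply expansion_in, (productE _ _ hJ); split; apply (omega_emp hw). Qed.

(** Equality of the expansions at one pair yields the same digit there and equality at the next
    pair. The walk visits only pairs with [m] at most [n], whence the restriction. *)
Lemma real_of_inj s s' : real_of s = real_of s' ->
  forall m n, m ∈ w -> n ∈ w -> m ∈ n \/ m = n -> (pr m n ∈ s <-> pr m n ∈ s').
Proof.
intros E m n Hm Hn Hmn.
assert (H : forall p, p ∈ J -> expansion s p = expansion s' p ->
  (p ∈ s <-> p ∈ s') /\ expansion s (nxt p) = expansion s' (nxt p)).
{ intros p Hp H; rewrite (expansion_eq s Hp), (expansion_eq s' Hp) in H.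
  apply (nxt_in hw hJ) in Hp; apply digit_map_inj; auto using expansion_in. }
apply H; [apply (productE _ _ hJ); auto|].
apply (walk_ind hw hJ (P := fun p => expansion s p = expansion s' p)); auto; [dfn|].
intros p Hp Ep; apply H; auto.
Qed.

End Expansion.

(** * The reals *)

Section Reals.
Context {M : structure} {hZF : ZF M}.

Definition op2 (f x y : M) : M := desc (fun z => app2 f x y z).

Lemma op2_spec f X x y : binary_operation f X -> x ∈ X -> y ∈ X ->
  op2 f x y ∈ X /\ forall z, app2 f x y z <-> z = op2 f x y.
Proof.
intros [P [HP Hf]] Hx Hy.
assert (Hp : pr x y ∈ P) by (apply (productE _ _ HP); auto).
assert (E : forall z, app2 f x y z <-> z = ap f (pr x y)).
{ intros z; rewrite <- (apE z Hf Hp); split.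
  - intros [p [Ep H]]; apply opairE in Ep; congruence.
  - intros H; exists (pr x y); split; [apply pr_spec|exact H]. }
assert (Ed : op2 f x y = ap f (pr x y)).
{ apply desc_eq; [apply E; reflexivity|intros z; apply E]. }
rewrite Ed; split; [exact (ap_in Hf Hp)|exact E].
Qed.

Variables R plus times lt zero one : M.
Hypothesis hR : complete_ordered_field R plus times lt zero one.

Notation "x + y" := (op2 plus x y).
Notation "x * y" := (op2 times x y).
Notation "x < y" := (app lt x y).
Definition lte x y := x < y \/ x = y.
Notation "x <= y" := (lte x y).
Notation "0" := zero.
Notation "1" := one.

Let R0 : 0 ∈ R := cof_zero hR.
Let R1 : 1 ∈ R := cof_one hR.

Lemma plus_in x y : x ∈ R -> y ∈ R -> x + y ∈ R.
Proof. apply (op2_spec (cof_plus hR)). Qed.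

Lemma times_in x y : x ∈ R -> y ∈ R -> x * y ∈ R.
Proof. apply (op2_spec (cof_times hR)). Qed.

Lemma plusE x y z : x ∈ R -> y ∈ R -> (app2 plus x y z <-> z = x + y).
Proof. intros Hx Hy; apply (op2_spec (cof_plus hR) Hx Hy). Qed.

Lemma timesE x y z : x ∈ R -> y ∈ R -> (app2 times x y z <-> z = x * y).
Proof. intros Hx Hy; apply (op2_spec (cof_times hR) Hx Hy). Qed.

Hint Resolve R0 R1 plus_in times_in : core.

Lemma plus_comm x y : x ∈ R -> y ∈ R -> x + y = y + x.
Proof.
intros Hx Hy; apply plusE; auto; apply (cof_plus_comm hR), plusE; auto.
Qed.

Lemma plus_assoc x y z : x ∈ R -> y ∈ R -> z ∈ R -> x + y + z = x + (y + z).
Proof.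
intros Hx Hy Hz; apply plusE; auto.
apply (cof_plus_assoc hR (x := x) (y := y) (z := z) (xy := x + y)); apply plusE; auto.
Qed.

Lemma plus_zero x : x ∈ R -> x + 0 = x.
Proof. intros Hx; symmetry; apply plusE; auto; apply (cof_plus_zero hR Hx). Qed.

Lemma zero_plus x : x ∈ R -> 0 + x = x.
Proof. intros Hx; rewrite plus_comm; auto using plus_zero. Qed.

Lemma opp_exists x : x ∈ R -> exists n, n ∈ R /\ x + n = 0.
Proof.
intros Hx; destruct (cof_plus_opp hR Hx) as [n [Hn H]]; exists n; split; [exact Hn|].
symmetry; apply plusE; auto.
Qed.

Lemma plus_cancel x y z : x ∈ R -> y ∈ R -> z ∈ R -> x + z = y + z -> x = y.
Proof.
intros Hx Hy Hz E; destruct (opp_exists Hz) as [n [Hn Ez]].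
rewrite <- (plus_zero Hx), <- (plus_zero Hy), <- Ez, <- !plus_assoc, E; auto.
Qed.

Lemma times_comm x y : x ∈ R -> y ∈ R -> x * y = y * x.
Proof.
intros Hx Hy; apply timesE; auto; apply (cof_times_comm hR), timesE; auto.
Qed.

Lemma times_one x : x ∈ R -> x * 1 = x.
Proof. intros Hx; symmetry; apply timesE; auto; apply (cof_times_one hR Hx). Qed.

Lemma distr x y z : x ∈ R -> y ∈ R -> z ∈ R -> x * (y + z) = x * y + x * z.
Proof.
intros Hx Hy Hz; apply plusE; auto.
apply (cof_distr hR (x := x) (y := y) (z := z) (yz := y + z));
  first [apply plusE; solve [auto] | apply timesE; auto].
Qed.

Lemma times_zero x : x ∈ R -> x * 0 = 0.
Proof.
intros Hx; apply plus_cancel with (x * 0); auto.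
rewrite <- distr, !zero_plus; auto.
Qed.

Lemma lt_in x y : x < y -> x ∈ R /\ y ∈ R.
Proof.
intros H; apply appE, (cof_lt hR) in H; destruct H as [a [b [Ha [Hb E]]]].
apply opairE, pr_inj in E; destruct E as [-> ->]; auto.
Qed.

Lemma lt_irrefl x : ~ x < x.
Proof. apply (cof_lt_irrefl hR). Qed.

Lemma lt_trans x y z : x < y -> y < z -> x < z.
Proof. apply (cof_lt_trans hR). Qed.

Lemma lt_plus x y z : x < y -> z ∈ R -> x + z < y + z.
Proof.
intros H Hz; destruct (lt_in H) as [Hx Hy].
apply (cof_lt_plus hR H (z := z)); apply plusE; auto.
Qed.

Lemma lt_times_pos x y : 0 < x -> 0 < y -> 0 < x * y.
Proof.
intros Hx Hy; apply (cof_lt_times hR Hx Hy), timesE; first [apply (lt_in Hx)|apply (lt_in Hy)|auto].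
Qed.

(** Multiply the positive difference [y + n] by [t], where [n] is the opposite of [x], and add
    [t * x] back. *)
Lemma lt_times t x y : 0 < t -> x < y -> t * x < t * y.
Proof.
intros Ht H; destruct (lt_in Ht) as [_ Rt], (lt_in H) as [Hx Hy].
destruct (opp_exists Hx) as [n [Hn E]].
assert (P : 0 < t * (y + n)).
{ apply lt_times_pos; [exact Ht|]; rewrite <- E; apply lt_plus; auto. }
apply (lt_plus (z := t * x)) in P; auto.
rewrite zero_plus, <- distr, plus_assoc, (plus_comm Hn Hx), E, plus_zero in P; auto.
Qed.

Lemma zero_lt_one : 0 < 1.
Proof.
destruct (cof_lt_total hR R0 R1) as [H|[H|H]]; [exact H| |].
- exfalso; apply (cof_one_neq_zero hR); auto.
(* If 1 were negative, its opposite [n] would be positive, and 1 is the square of [n]. *)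
- destruct (opp_exists R1) as [n [Hn E]].
  pose proof (lt_plus H Hn) as P; rewrite E, (zero_plus Hn) in P.
  replace 1 with (n * n); [apply lt_times_pos; exact P|].
  apply plus_cancel with n; auto.
  rewrite E; rewrite <- (times_one Hn) at 3; rewrite <- distr, plus_comm, E, times_zero; auto.
Qed.

Lemma third_exists : exists t, 0 < t /\ t + (t + t) = 1.
Proof.
pose (u := 1 + (1 + 1)).
assert (Ru : u ∈ R) by (unfold u; auto).
assert (P : 0 < u).
{ apply lt_trans with (1 + 1).
  - apply lt_trans with 1; [apply zero_lt_one|].
    rewrite <- (zero_plus R1) at 1; apply lt_plus, R1; apply zero_lt_one.
  - rewrite <- (zero_plus (plus_in R1 R1)) at 1; apply lt_plus; auto; apply zero_lt_one. }
destruct (cof_times_inv hR Ru) as [t [Rt Et]].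
{ intros E; rewrite E in P; exact (lt_irrefl P). }
apply timesE in Et; auto.
exists t; split.
- destruct (cof_lt_total hR R0 Rt) as [H|[<-|H]]; [exact H| |].
  + exfalso; rewrite times_zero in Et; auto; apply (cof_one_neq_zero hR Et).
  (* If [t] is negative, its opposite [n] is positive and so is [u * n]; adding 1, which is [u * t],
     to both sides gives [1 < 0]. *)
  + exfalso; destruct (opp_exists Rt) as [n [Hn E]].
    assert (Q : 0 < n) by (apply (lt_plus (z := n)) in H; auto; rewrite E, zero_plus in H; auto).
    apply (lt_times_pos P), (lt_plus (z := 1)) in Q; auto.
    rewrite Et in Q at 2; rewrite (plus_comm (x := u * n)), <- distr, E, times_zero, zero_plus in Q; auto.
    exact (lt_irrefl (lt_trans zero_lt_one Q)).
- rewrite times_comm in Et; auto; unfold u in Et; rewrite !distr, !times_one in Et; auto.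
Qed.

Lemma lte_trans x y z : x <= y -> y <= z -> x <= z.
Proof.
intros [H|<-] [H'|<-]; [left; exact (lt_trans H H')|left; exact H|left; exact H'|right; reflexivity].
Qed.

Lemma lte_antisym x y : x <= y -> y <= x -> x = y.
Proof.
intros [H|H] [H'|H']; auto; exfalso; exact (lt_irrefl (lt_trans H H')).
Qed.

Lemma lt_not_lte x y : x < y -> ~ y <= x.
Proof. intros H [H'| ->]; [exact (lt_irrefl (lt_trans H H'))|exact (lt_irrefl H)]. Qed.

Lemma strict_mono_inj (L : M -> M) : (forall x y, x < y -> L x < L y) ->
  forall x y, x ∈ R -> y ∈ R -> L x = L y -> x = y.
Proof.
intros S x y Hx Hy E; destruct (cof_lt_total hR Hx Hy) as [H|[H|H]]; [|exact H|];
  exfalso; apply S in H; rewrite E in H; exact (lt_irrefl H).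
Qed.

Lemma strict_mono (L : M -> M) : (forall x y, x < y -> L x < L y) ->
  forall x y, x <= y -> L x <= L y.
Proof. intros S x y [H| ->]; [left; auto|right; reflexivity]. Qed.

(** [U] is the unit interval, and the two maps send it into [[0, t]] and [[t + t, 1]] with [t] one
    third. The gap between these intervals makes the images disjoint, which halves would not do. *)
Lemma reals_cantor_system : exists U L0 L1,
  subset U R /\ cantor_system U zero lte L0 L1.
Proof.
destruct third_exists as [t [Pt Et]]; destruct (lt_in Pt) as [_ Rt].
destruct (@sep M hZF (fun x => 0 <= x /\ x <= 1) R) as [U HU]; [dfn|].
pose (L0 x := t * x); pose (L1 x := t * x + (t + t)).
assert (S0 : forall x y, x < y -> L0 x < L0 y) by (intros x y; apply lt_times, Pt).
assert (S1 : forall x y, x < y -> L1 x < L1 y) by (intros x y H; apply lt_plus; auto).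
assert (E00 : L0 0 = 0) by (apply times_zero, Rt).
assert (E01 : L0 1 = t) by (apply times_one, Rt).
assert (E10 : L1 0 = t + t) by (unfold L1; rewrite times_zero, zero_plus; auto).
assert (E11 : L1 1 = 1) by (unfold L1; rewrite times_one; auto).
assert (T2 : t < t + t) by (rewrite <- (zero_plus Rt) at 1; apply lt_plus; auto).
assert (T3 : t + t < 1).
{ rewrite <- Et; rewrite <- (zero_plus (plus_in Rt Rt)) at 1; apply lt_plus; auto. }
assert (UR : subset U R) by (intros x Hx; apply HU, Hx).
assert (I0 : forall x, x ∈ U -> 0 <= L0 x /\ L0 x <= t).
{ intros x Hx; apply HU in Hx; destruct Hx as [_ [A B]].
  rewrite <- E00 at 1; rewrite <- E01; split; apply (strict_mono S0); auto. }
assert (I1 : forall x, x ∈ U -> t + t <= L1 x /\ L1 x <= 1).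
{ intros x Hx; apply HU in Hx; destruct Hx as [_ [A B]].
  rewrite <- E10, <- E11; split; apply (strict_mono S1); rewrite ?E11; auto. }
exists U, L0, L1; split; [exact UR|]; split.
- intros x _; right; reflexivity.
- intros x y z _ _ _; apply lte_trans.
- intros x y _ _; apply lte_antisym.
- apply HU; split; [auto|split; [right; reflexivity|left; apply zero_lt_one]].
- intros x Hx; apply HU, Hx.
- intros X XU [x0 Hx0].
  assert (X1 : forall x, x ∈ X -> x <= 1) by (intros x Hx; apply HU, XU, Hx).
  destruct (cof_complete hR (X := X)) as [l [Rl [Ub Lb]]].
  + intros x Hx; apply UR, XU, Hx.
  + exists x0; exact Hx0.
  + exists 1; auto.
  + exists l; split; [|split; [exact Ub|]].
    * apply HU; split; [exact Rl|split; [|apply Lb; auto]].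
      apply lte_trans with x0; [apply HU, XU, Hx0|apply Ub, Hx0].
    * intros b Hb; apply Lb, UR, Hb.
- intros x Hx; destruct (I0 x Hx) as [A B]; apply HU; split; [unfold L0; auto|split; [exact A|]].
  apply (lte_trans B); left; exact (lt_trans T2 T3).
- intros x Hx; destruct (I1 x Hx) as [A B]; apply HU; split; [unfold L1; auto|split; [|exact B]].
  refine (lte_trans _ A); left; exact (lt_trans Pt T2).
- intros x y _ _; apply (strict_mono S0).
- intros x y _ _; apply (strict_mono S1).
- intros x y Hx Hy; apply (strict_mono_inj S0); auto.
- intros x y Hx Hy; apply (strict_mono_inj S1); auto.
- intros x y Hx Hy E; apply (lt_not_lte T2).
  apply lte_trans with (L1 y); [apply I1, Hy|rewrite <- E; apply I0, Hx].
- dfn.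
- unfold L0; dfn.
- unfold L1; dfn.
Qed.

End Reals.

(** * Order types, and the map to ω₁ *)

Section OrderTypes.
Context {M : structure} {hZF : ZF M}.
Variable w : M.
Hypothesis hw : is_omega w.

(* s encodes a copy of the ordinal a on a subset of ω: the diagonal of s is the
   domain of the copy, and only pairs (m, n) with m <= n are looked at. *)
Definition has_type (s a : M) : Prop :=
  is_ordinal a /\ exists h, is_function h a w /\ injective h /\
    (forall n, n ∈ w -> (pr n n ∈ s <-> exists b, b ∈ a /\ ap h b = n)) /\
    (forall b c, b ∈ a -> c ∈ a -> ap h b ∈ ap h c ->
       (pr (ap h b) (ap h c) ∈ s <-> b ∈ c)).

Lemma injective_ap f A B x y : is_function f A B -> injective f ->
  x ∈ A -> y ∈ A -> ap f x = ap f y -> x = y.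
Proof.
intros Hf I Hx Hy E; apply (I x y (ap f x)); [apply (apE _ Hf Hx)|apply (apE _ Hf Hy)]; auto.
Qed.

Lemma has_type_exists a : is_ordinal a -> countable a -> exists s, has_type s a.
Proof.
intros Oa Ca; apply (countableE hw) in Ca; destruct Ca as [h [Hh Ih]].
(* The order is taken in reflexive form, so that the diagonal of [s] records the range of [h]. *)
destruct (rel_exists w w (P := fun m n => exists b c, b ∈ a /\ c ∈ a /\ ap h b = m /\ ap h c = n /\
   (b = c \/ b ∈ c))) as [s [_ Hs]]; [dfn|].
exists s; split; [exact Oa|exists h; split; [exact Hh|split; [exact Ih|split]]].
- intros n Hn; split.
  + intros H; apply Hs in H; destruct H as [_ [_ [b [c [Hb [_ [E _]]]]]]]; eauto.
  + intros [b [Hb E]]; apply Hs; split; [|split]; auto; exists b, b; auto 10.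
- intros b c Hb Hc Hbc; split.
  + intros H; apply Hs in H; destruct H as [_ [_ [b' [c' [Hb' [Hc' [Eb [Ec H]]]]]]]].
    apply (injective_ap Hh Ih) in Eb, Ec; auto; subst b' c'.
    destruct H as [->|H]; [|exact H]; exfalso; exact (mem_irrefl Hbc).
  + intros H; apply Hs; split; [|split]; try (apply (ap_in Hh); assumption).
    exists b, c; auto 10.
Qed.

(** Elements of [a] and [a'] with the same number are matched: [T] and [T'] find partners, [O] and
    [O'] carry membership across in both directions, and [K] shows by membership induction and
    extensionality that partners are equal. *)
Lemma has_type_subset s s' a a' : has_type s a -> has_type s' a' ->
  (forall m n, m ∈ w -> n ∈ w -> m ∈ n \/ m = n -> (pr m n ∈ s <-> pr m n ∈ s')) ->
  subset a a'.
Proof.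
intros [Oa [h [Hh [Ih [Dh Rh]]]]] [Oa' [h' [Hh' [Ih' [Dh' Rh']]]]] E.
assert (T : forall b, b ∈ a -> exists b', b' ∈ a' /\ ap h' b' = ap h b).
{ intros b Hb; apply Dh', E, Dh; eauto using ap_in. }
assert (T' : forall b', b' ∈ a' -> exists b, b ∈ a /\ ap h b = ap h' b').
{ intros b Hb; apply Dh, E, Dh'; eauto using ap_in. }
assert (O : forall b c b' c', b ∈ a -> c ∈ a -> b' ∈ a' -> c' ∈ a' ->
  ap h b = ap h' b' -> ap h c = ap h' c' -> b ∈ c -> b' ∈ c').
{ intros b c b' c' Hb Hc Hb' Hc' Eb Ec H.
  assert (Wb := ap_in Hh Hb); assert (Wc := ap_in Hh Hc).
  destruct (omega_total hw Wb Wc) as [L|[L|L]].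
  - apply Rh' ; auto; rewrite <- Eb, <- Ec; auto; apply E; auto; apply Rh; auto.
  - apply (injective_ap Hh Ih) in L; auto; subst c; exfalso; exact (mem_irrefl H).
  (* Here [c] has the smaller number, so [s] says nothing about the pair in the order wanted.
     Totality in [a'] leaves two bad cases; the reversed membership would transfer back to
     [c ∈ b]. *)
  - destruct (ordinal_total (ordinal_mem Oa' Hb') (ordinal_mem Oa' Hc')) as [L'|[L'|L']]; auto.
    + exfalso; subst c'; rewrite Eb, Ec in L; exact (mem_irrefl L).
    + exfalso; apply (mem_asym H), Rh; auto; apply E; auto.
      rewrite Eb, Ec in *; apply Rh'; auto. }
assert (O' : forall b c b' c', b ∈ a -> c ∈ a -> b' ∈ a' -> c' ∈ a' ->
  ap h b = ap h' b' -> ap h c = ap h' c' -> b' ∈ c' -> b ∈ c).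
{ intros b c b' c' Hb Hc Hb' Hc' Eb Ec H.
  destruct (ordinal_total (ordinal_mem Oa Hb) (ordinal_mem Oa Hc)) as [L|[L|L]]; auto; exfalso.
  - subst c; rewrite Eb in Ec; apply (injective_ap Hh' Ih') in Ec; auto; subst c'.
    exact (mem_irrefl H).
  - apply (mem_asym H); exact (O c b c' b' Hc Hb Hc' Hb' Ec Eb L). }
assert (K : forall b, b ∈ a -> forall b', b' ∈ a' -> ap h b = ap h' b' -> b = b').
{ apply (@mem_ind_on M hZF a (fun b => forall b', b' ∈ a' -> ap h b = ap h' b' -> b = b')); [dfn|].
  intros b Hb IH b' Hb' Eb; apply ext; intros c; split; intros Hc.
  - assert (Ac : c ∈ a) by exact (ordinal_transitive Oa Hb Hc).
    destruct (T c Ac) as [c' [Hc' Ec]]; rewrite (IH c Ac Hc c') by auto.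
    apply (O c b c' b'); auto.
  - assert (Ac : c ∈ a') by exact (ordinal_transitive Oa' Hb' Hc).
    destruct (T' c Ac) as [d [Hd Ed]].
    assert (Hdb : d ∈ b) by (apply (O' d b c b'); auto).
    rewrite <- (IH d Hd Hdb c); auto. }
intros b Hb; destruct (T b Hb) as [b' [Hb' Eb]]; rewrite (K b Hb b'); auto.
Qed.

Lemma has_type_unique s s' a a' : has_type s a -> has_type s' a' ->
  (forall m n, m ∈ w -> n ∈ w -> m ∈ n \/ m = n -> (pr m n ∈ s <-> pr m n ∈ s')) ->
  a = a'.
Proof.
intros H H' E; apply ext; intros z; split; [apply (has_type_subset H H' E)|].
apply (has_type_subset H' H); intros; symmetry; apply E; auto.
Qed.

Lemma has_type_countable s a : has_type s a -> is_ordinal a /\ countable a.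
Proof.
intros [Oa [h [Hh [Ih _]]]]; split; [exact Oa|apply (countableE hw); eauto].
Qed.

Lemma countable_subset (X Y : M) : countable X -> subset Y X -> countable Y.
Proof.
intros C S; apply (countableE hw) in C; destruct C as [f [Hf I]].
apply (countable_of_enum hw (S := fun n x => n = ap f x)); [dfn| |].
- intros x Hx; exists (ap f x); split; [apply (ap_in Hf), S, Hx|reflexivity].
- intros n x x' Hx Hx' -> E; apply (injective_ap Hf I); auto.
Qed.

(** An initial segment of the ordinals is an ordinal; if [W] were countable, it would be one of its
    own elements. *)
Lemma omega1_of_countable_ordinals (W : M) :
  (forall a, a ∈ W <-> is_ordinal a /\ countable a) -> is_omega1 W.
Proof.
intros HW.
assert (O : is_ordinal W).
{ apply ordinalE; split.
  - intros a Ha b Hb; apply HW in Ha; destruct Ha as [Oa Ca]; apply HW; split.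
    + exact (ordinal_mem Oa Hb).
    + apply (countable_subset Ca); intros c Hc; exact (ordinal_transitive Oa Hb Hc).
  - intros a b Ha Hb; apply ordinal_total; [apply HW, Ha|apply HW, Hb]. }
split; [exact O|split].
- intros C; apply (@mem_irrefl M hZF W), HW; auto.
- intros a Ha; apply HW, Ha.
Qed.

End OrderTypes.

(** * From a colouring and codes to a countable-to-one map *)

Section Colouring.
Context {M : structure} {hZF : ZF M}.
Variables w R R2 c : M.
Hypothesis hw : is_omega w.
Hypothesis hR2 : is_product R2 R R.
Hypothesis hc : is_function c R2 w.
Hypothesis hT : forall e, Gamma_T R R2 e -> ~ monochromatic c e.

(** The fourth corner [(x', y')] completes the three points to the product of [{x, x'}] and
    [{y, y'}], so they form an edge of [Gamma_T]. *)
Lemma no_monochromatic_corner x x' y y' : x ∈ R -> x' ∈ R -> y ∈ R -> y' ∈ R ->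
  x <> x' -> y <> y' -> ap c (pr x y) = ap c (pr x' y) -> ap c (pr x y) = ap c (pr x y') ->
  False.
Proof.
intros Hx Hx' Hy Hy' Nx Ny Ex Ey.
assert (In : forall u v, u ∈ R -> v ∈ R -> pr u v ∈ R2)
  by (intros u v Hu Hv; apply (productE _ _ hR2); auto).
destruct (@sep M hZF (fun p => p = pr x y \/ p = pr x' y \/ p = pr x y') R2) as [e He]; [dfn|].
assert (He' : forall p, p ∈ e <-> p = pr x y \/ p = pr x' y \/ p = pr x y').
{ intros p; rewrite (He p); split; [tauto|]; intros H; split; [|exact H].
  destruct H as [-> | [-> | ->]]; auto. }
apply (hT (e := e)).
- split; [intros p Hp; apply He, Hp|split].
  + exists (pr x y), (pr x' y), (pr x y'); split; [|split; [|split; [|exact He']]];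
      intros E; apply pr_inj in E; destruct E; auto.
  + destruct (zf_pairing hZF x x') as [a Ha], (zf_pairing hZF y y') as [b Hb].
    destruct (product_exists a b) as [e' P].
    exists (pr x' y'), e'; split; [auto|split].
    * intros p; split.
      -- intros Hp; destruct (product_elim P Hp) as [u [v [Hu [Hv ->]]]].
         apply Ha in Hu; apply Hb in Hv; rewrite (He' (pr u v)).
         destruct Hu as [-> | ->], Hv as [-> | ->]; auto.
      -- intros H; rewrite (He' p) in H.
         destruct H as [[-> | [-> | ->]] | ->]; apply (productE _ _ P); split;
           first [apply Ha|apply Hb]; auto.
    * exists a, b; split; [|split; [|split; [|split; [|exact P]]]].
      -- intros u Hu; apply Ha in Hu; destruct Hu as [-> | ->]; auto.
      -- exists x, x'; auto.
      -- intros u Hu; apply Hb in Hu; destruct Hu as [-> | ->]; auto.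
      -- exists y, y'; auto.
- exists (ap c (pr x y)); intros p Hp; apply He' in Hp.
  destruct Hp as [-> | [-> | ->]]; apply (apE _ hc); auto.
Qed.

(* In the notation of the header: z is in A_x. *)
Definition alone (x z : M) : Prop :=
  z ∈ R /\ forall z', z' ∈ R -> ap c (pr x z') = ap c (pr x z) -> z' = z.

Variable W : M.
Variable code : M -> M -> Prop.
Hypothesis hW : is_omega1 W.
Hypothesis Dcode : Def (fun r => code (r 0) (r 1)).
Hypothesis code_fun : forall z a a', code z a -> code z a' -> a = a'.
Hypothesis code_ex : forall a, a ∈ W -> exists z, z ∈ R /\ code z a.

Definition seen (x a : M) : Prop := exists z, alone x z /\ code z a.

(** Otherwise [W] would be countable: index [a] by the colours [c (x, z)] of its codes [z] in the
    set A_x. Such a colour determines [z], because [z] is alone with it in the column of [x], and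
    [z] determines [a]. *)
Lemma unseen_exists x : x ∈ R -> exists a, a ∈ W /\ ~ seen x a.
Proof.
intros Hx; apply NNPP; intros N; apply (proj1 (proj2 hW)).
apply (countable_of_enum hw (S := fun n a => exists z, alone x z /\ code z a /\ n = ap c (pr x z)));
  [dfn| |].
- intros a Ha; assert (H : seen x a) by (apply NNPP; intros H; eauto).
  destruct H as [z [Az Cz]]; exists (ap c (pr x z)); split; [|eauto].
  apply (ap_in hc), (productE _ _ hR2); split; [exact Hx|apply Az].
- intros n a a' _ _ [z [Az [Cz ->]]] [z' [Az' [Cz' E]]].
  assert (z' = z) as -> by (apply Az; [apply Az'|auto]).
  exact (code_fun Cz Cz').
Qed.

Lemma countable_to_one_exists : exists f, is_function f R W /\ countable_to_one f W.
Proof.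
destruct (@fun_exists M hZF R W (fun x a => a ∈ W /\ ~ seen x a /\ forall b, b ∈ W -> b ∈ a -> seen x b))
  as [f [Hf Ef]]; [dfn| | |].
- intros x Hx.
  destruct (@foundation_sep M hZF W (fun a => ~ seen x a)) as [a [Ha [Sa Ma]]];
    [dfn|apply unseen_exists, Hx|].
  exists a; split; [exact Ha|split; [exact Ha|split; [exact Sa|]]].
  intros b Hb Hba; apply NNPP, (Ma b Hb Hba).
- intros x a a' _ [Ha [Sa Ma]] [Ha' [Sa' Ma']].
  destruct (proj2 (proj1 (ordinalE _) (proj1 hW)) a a' Ha Ha') as [H|[H|H]]; [|exact H|];
    exfalso; auto.
- exists f; split; [exact Hf|]; intros a Ha.
  destruct (@sep M hZF (fun x => app f x a) R) as [F HF]; [dfn|].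
  exists F; split.
  + intros x; rewrite (HF x); split; [tauto|]; intros H; split; [|exact H].
    apply (app_in Hf H).
  (* A single code [z] of [a] serves the whole fiber: [a] is unseen by each [x] there, so [z] is not
     alone in the column of [x]. *)
  + destruct (code_ex Ha) as [z [Hz Cz]].
    assert (NA : forall x, x ∈ F -> x ∈ R /\ ~ alone x z).
    { intros x Hx; apply HF in Hx; destruct Hx as [Hx H]; split; [exact Hx|].
      intros Az; apply appE, Ef in H; apply H; exists z; auto. }
    apply (countable_of_enum hw (S := fun n x => n = ap c (pr x z))); [dfn| |].
    * intros x Hx; exists (ap c (pr x z)); split; [|reflexivity].
      apply (ap_in hc), (productE _ _ hR2); split; [apply NA, Hx|exact Hz].
    (* Suppose that [x] and [x'] are distinct with equal colours in row [z]. Any other [z'] sharing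
       this colour in the column of [x] completes a forbidden corner, so [z] would be alone
       there. *)
    * intros n x x' Hx Hx' -> E; apply NNPP; intros N.
      destruct (NA x Hx) as [Rx Ax], (NA x' Hx') as [Rx' _].
      apply Ax; split; [exact Hz|]; intros z' Hz' E'; apply NNPP; intros N'.
      apply (no_monochromatic_corner (x := x) (x' := x') (y := z) (y' := z')); auto.
Qed.

End Colouring.

Theorem theorem6p5 (M : structure) (hZF : ZF M) (R R2 : M)
    (hR : is_reals R) (hR2 : is_product R2 R R)
    (hT : countable_chromatic_number R2 (Gamma_T R R2)) :
  exists w1 f : M,
    is_omega1 w1 /\ is_function f R w1 /\ countable_to_one f w1.
Proof.
destruct hR as [plus [times [lt [zero [one H]]]]], hT as [w [c [hw [hc Hc]]]].
destruct (reals_cantor_system H) as [U [L0 [L1 [UR S]]]].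
destruct (product_exists w w) as [J hJ].
pose (K := real_of J U (lte lt) L0 L1).
(* An ordinal may have many codes, and [s] is any element of the model: only its pairs of natural
   numbers matter. *)
pose (code := fun z a => exists s, z = K s /\ has_type w s a).
assert (DK : DefTerm (fun r => K (r 0))) by exact (DefTerm_real_of J S).
assert (Dcode : Def (fun r => code (r 0) (r 1))) by (unfold code; dfn).
assert (code_fun : forall z a a', code z a -> code z a' -> a = a').
(* Equal reals give agreement only at pairs with [m] at most [n], which is exactly what
   [has_type_unique] asks for. *)
{ intros z a a' [s [-> T]] [s' [E T']]; apply (has_type_unique hw T T').
  apply (real_of_inj hw hJ S E). }
(* The countable ordinals form a set because they are the image of [R] under the partial function
   [code]. *)
destruct (@replacement M hZF code R Dcode) as [W HW].
{ intros z a a' _; apply code_fun. }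
assert (HW' : forall a, a ∈ W <-> is_ordinal a /\ countable a).
{ intros a; rewrite (HW a); split.
  - intros [z [_ [s [_ T]]]]; exact (has_type_countable hw T).
  - intros [Oa Ca]; destruct (has_type_exists hw Oa Ca) as [s T].
    exists (K s); split; [apply UR, (real_of_in hw hJ S)|exists s; auto]. }
assert (W1 := omega1_of_countable_ordinals hw HW').
destruct (countable_to_one_exists hw hR2 hc Hc W1 Dcode code_fun) as [f Hf].
- intros a Ha; apply HW, Ha.
- exists W, f; auto.
Qed.
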